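(* Let $b_{25}(n)$ denote the number of $25$-regular partitions of $n$. For all $\alpha\ge1$, $\beta\ge0$, $n\ge0$ and $i\in\{1,2\}$, $$b_{25}\left(2^{4\beta}3^{4\alpha}\cdot n+(i+3)\cdot2^{4\beta}3^{4\alpha-1}-1\right)\equiv0\pmod5$$ and $$b_{25}\left(2^{4\alpha}3^{4\beta}\cdot n+2^{4\alpha-1}3^{4\beta+1}-1\right)\equiv0\pmod5.$$
   Context: For $\ell\ge2$, a partition is $\ell$-regular if none of its parts is divisible by $\ell$; $b_\ell(n)$ is the number of $\ell$-regular partitions of $n$, with $b_\ell(0)=1$, and $\sum_{n\ge0}b_\ell(n)q^n=\prod_{n\ge1}\frac{1-q^{\ell n}}{1-q^n}$. *)

(* Defs.v *)
From mathcomp Require Import all_boot.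

Set Implicit Arguments.
Unset Strict Implicit.
Unset Printing Implicit Defensive.

(* Partitions as weakly decreasing sequences of positive parts. *)
Definition is_partition (n : nat) (s : seq nat) : bool :=
  [&& sorted geq s, all (leq 1) s & sumn s == n].

Definition regular (l : nat) (s : seq nat) : bool :=
  all (fun k => ~~ (l %| k)) s.

(* A partition of n has at most n parts, each at most n, so it lies in the
   finite type of sequences of length at most n over {0, ..., n}; see
   partition_in_bseq. *)
Definition parts (n : nat) (s : n.-bseq 'I_n.+1) : seq nat :=
  [seq val k | k <- s].

Definition num_regular_partitions (l n : nat) : nat :=
  #|[set s : n.-bseq 'I_n.+1 | is_partition n (parts s) && regular l (parts s)]|.

Lemma parts_inj n : injective (@parts n).
Proof. by move=> s t /(inj_map val_inj) /val_inj. Qed.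

Lemma partition_in_bseq n (s : seq nat) :
  is_partition n s -> exists t : n.-bseq 'I_n.+1, parts t = s.
Proof.
case/and3P=> _ pos_s /eqP sum_s.
have size_s : size s <= n.
  rewrite -sum_s; elim: s pos_s {sum_s} => //= k s IHs /andP[k_gt0 /IHs le_s].
  by rewrite -add1n leq_add.
have le_s k : k \in s -> k <= n.
  rewrite -sum_s; elim: s {pos_s sum_s size_s} => //= j s IHs.
  rewrite inE => /predU1P[->|/IHs le_k]; first exact: leq_addr.
  exact: leq_trans le_k (leq_addl _ _).
have size_t : size [seq inord k : 'I_n.+1 | k <- s] <= n by rewrite size_map.
exists (Bseq size_t); rewrite /parts /= -map_comp map_id_in // => k /le_s le_k.
by rewrite /= inordK.
Qed.

Lemma num_regular_partitions0 l : num_regular_partitions l 0 = 1.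
Proof.
rewrite /num_regular_partitions -[RHS](cards1 ([bseq] : 0.-bseq 'I_1)).
by congr #|pred_of_set _|; apply/setP=> s; rewrite (bseq0 s) !inE eqxx.
Qed.

(* Main.v *)
(* Modulo 5, 1 - q^(25n) = (1 - q^n)^25, so the generating function of b_25 is
   prod (1 - q^n)^24 and b_25(n - 1) = tau(n), Ramanujan's function. The Hecke
   relations
     tau(2n) = -24 tau(n) - 2^11 tau(n/2),  tau(3n) = 252 tau(n) - 3^11 tau(n/3)
   make k |-> tau(p^k m), for p = 2, 3 and p not dividing m, a linear recurrent
   sequence which modulo 5 has period 4 and vanishes at k = 3.

   Write E_d = prod (1 - q^(dn)). For p = 3, Jacobi's series for E_1^3 splits as
   P(q^3) - 3 q E_9^3, and the norm of E_1 under q |-> wq, with w a primitive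
   cube root of unity, gives P^3 E_3^3 = E_1^12 + 27 q E_3^12; the terms of
   (P(q^3) - 3 q E_9^3)^8 with exponent 2 mod 3 then recombine into the Hecke
   relation. For p = 2, with phi = sum (-1)^n q^(n^2) = E_1^2 / E_2 and
   psi = sum q^(n(n+1)/2) = E_2^2 / E_1, one has E_1^24 = phi^12 E_2^12 and
   phi^2 = A(q^2) - 4 q B(q^2), where A B = psi^4 and A^2 - 16 q B^2 = phi^4.
   The three theta series come from one finite form of the triple product. *)
Require Import Defs.
From HB Require Import structures.
From mathcomp Require Import all_boot all_algebra all_field.
From mathcomp Require Import boolp.
From mathcomp Require Import ring zify.

Set Implicit Arguments.
Unset Strict Implicit.
Unset Printing Implicit Defensive.

Import GRing.Theory.
Local Open Scope ring_scope.

(** * Formal power series *)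

Record fps (R : comNzRingType) := Fps {coefs :> nat -> R}.

(* Locked: conversion must not evaluate coefficients. *)
HB.lock Definition fps_mul (R : comNzRingType) (f g : fps R) : fps R :=
  Fps (fun n => \sum_(i < n.+1) f i * g (n - i)%N).

(* f(q) |-> f(q^d); for d = 0 this is the constant coefficient of f. *)
HB.lock Definition fps_sub (R : comNzRingType) d (f : fps R) : fps R :=
  Fps (fun n => if (d %| n)%N then f (n %/ d)%N else 0).

HB.lock Definition fps_tw (R : comNzRingType) (w : R) (f : fps R) : fps R :=
  Fps (fun n => w ^+ n * f n).

Arguments fps_mul {R}.
Arguments fps_sub {R}.
Arguments fps_tw {R}.

Section PowerSeries.

Variable R : comNzRingType.
Implicit Types (f g h : fps R).

Lemma fpsP f g : (forall n, f n = g n) -> f = g.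
Proof. by case: f g => [f] [g] /= fg; congr Fps; apply: funext. Qed.

(** Equality of coefficient sequences is not decidable, so the equality and choice structures
    required by the ring hierarchy are the classical ones. *)
HB.instance Definition _ := gen_eqMixin (fps R).
HB.instance Definition _ := gen_choiceMixin (fps R).

Definition fps0 : fps R := Fps (fun=> 0).
Definition fps_opp f := Fps (fun n => - f n).
Definition fps_add f g := Fps (fun n => f n + g n).

Fact fps_addA : associative fps_add.
Proof. by move=> f g h; apply: fpsP => n /=; rewrite addrA. Qed.
Fact fps_addC : commutative fps_add.
Proof. by move=> f g; apply: fpsP => n /=; rewrite addrC. Qed.
Fact fps_add0 : left_id fps0 fps_add.
Proof. by move=> f; apply: fpsP => n /=; rewrite add0r. Qed.
Fact fps_addN : left_inverse fps0 fps_opp fps_add.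
Proof. by move=> f; apply: fpsP => n /=; rewrite addNr. Qed.

HB.instance Definition _ :=
  GRing.isZmodule.Build (fps R) fps_addA fps_addC fps_add0 fps_addN.

Definition fps_trunc N f : {poly R} := \poly_(i < N) f i.

Lemma coef_fps_mul f g n : fps_mul f g n = \sum_(i < n.+1) f i * g (n - i)%N.
Proof. by rewrite fps_mul.unlock. Qed.

Lemma coef_fps_sub d f n :
  fps_sub d f n = if (d %| n)%N then f (n %/ d)%N else 0.
Proof. by rewrite fps_sub.unlock. Qed.

Lemma coef_fps_tw w f n : fps_tw w f n = w ^+ n * f n.
Proof. by rewrite fps_tw.unlock. Qed.

Definition fps1 : fps R := Fps (fun n => (n == 0)%:R).

Lemma coef_fps_trunc N f i : (i < N)%N -> (fps_trunc N f)`_i = f i.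
Proof. by rewrite coef_poly => ->. Qed.

(** Imports associativity and commutativity from polynomials: a coefficient of index below N only
    sees the truncations. *)
Lemma fps_mul_trunc N f g n : (n < N)%N ->
  fps_mul f g n = (fps_trunc N f * fps_trunc N g)`_n.
Proof.
move=> ltnN; rewrite coefM coef_fps_mul; apply: eq_bigr => i _.
by rewrite !coef_fps_trunc //; have := ltn_ord i; lia.
Qed.

Fact fps_mulA : associative (@fps_mul R).
Proof.
move=> f g h; apply: fpsP => n; set F := fps_trunc n.+1.
transitivity (F f * (F g * F h))`_n.
  rewrite coefM coef_fps_mul; apply: eq_bigr => i _.
  by rewrite coef_fps_trunc // -(fps_mul_trunc (N := n.+1)) //; lia.
rewrite mulrA coefM coef_fps_mul; apply: eq_bigr => i _.
by rewrite -(fps_mul_trunc (N := n.+1)) ?coef_fps_trunc //; lia.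
Qed.
Fact fps_mulC : commutative (@fps_mul R).
Proof.
by move=> f g; apply: fpsP => n; rewrite !(@fps_mul_trunc n.+1) // mulrC.
Qed.
Fact fps_mul1 : left_id fps1 (@fps_mul R).
Proof.
move=> f; apply: fpsP => n; rewrite coef_fps_mul big_ord_recl big1 ?addr0 /= => [|i _].
  by rewrite mul1r subn0.
by rewrite mul0r.
Qed.
Fact fps_mulDl : left_distributive (@fps_mul R) fps_add.
Proof.
move=> f g h; apply: fpsP => n /=; rewrite !coef_fps_mul -big_split.
by apply: eq_bigr => i _; rewrite mulrDl.
Qed.
Fact fps_1neq0 : fps1 != 0.
Proof.
apply/eqP => /(congr1 (fun f : fps R => f 0%N)) /= /eqP.
by rewrite oner_eq0.
Qed.

HB.instance Definition _ := GRing.Zmodule_isComNzRing.Build (fps R)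
  fps_mulA fps_mulC fps_mul1 fps_mulDl fps_1neq0.

Lemma coef_fps1 n : (1 : fps R) n = (n == 0)%:R. Proof. by []. Qed.
Lemma coef_fpsD f g n : (f + g) n = f n + g n. Proof. by []. Qed.
Lemma coef_fpsN f n : (- f) n = - f n. Proof. by []. Qed.
Lemma coef_fpsB f g n : (f - g) n = f n - g n. Proof. by []. Qed.
Lemma coef_fpsM f g n : (f * g) n = \sum_(i < n.+1) f i * g (n - i)%N.
Proof. exact: coef_fps_mul. Qed.
Lemma coef_fpsM_trunc N f g n : (n < N)%N ->
  (f * g) n = (fps_trunc N f * fps_trunc N g)`_n.
Proof. exact: fps_mul_trunc. Qed.
Lemma coef_fpsMn f k n : (f *+ k) n = f n *+ k.
Proof. by elim: k => [|k IHk]; rewrite ?mulr0n // !mulrS coef_fpsD IHk. Qed.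

Lemma coef_fps_natM k f n : (k%:R * f) n = k%:R * f n.
Proof. by rewrite !mulr_natl coef_fpsMn. Qed.

Lemma coef_fpsM0 f g : (f * g) 0%N = f 0%N * g 0%N.
Proof. by rewrite coef_fpsM big_ord1. Qed.

Lemma coef_fps_exp0 f k : (f ^+ k) 0%N = f 0%N ^+ k.
Proof. by elim: k => [|k IHk] //; rewrite !exprS coef_fpsM0 IHk. Qed.

Definition fpsX : fps R := Fps (fun n => (n == 1)%:R).

Lemma coef_fpsXM f n : (fpsX * f) n = if n is n'.+1 then f n' else 0.
Proof.
case: n => [|n]; rewrite coef_fpsM big_ord_recl /= mul0r ?add0r ?big_ord0 //.
rewrite big_ord_recl /= mul1r big1 ?addr0 => [|i _]; last by rewrite mul0r.
by congr (f _); rewrite /bump /=; lia.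
Qed.

Lemma coef_fpsXMS f n : (fpsX * f) n.+1 = f n.
Proof. exact: coef_fpsXM. Qed.

Lemma coef_fpsXn k n : (fpsX ^+ k) n = (n == k)%:R.
Proof.
elim: k n => [|k IHk] n //; rewrite exprS coef_fpsXM.
by case: n => [|n] //; rewrite IHk.
Qed.

(** A factor with constant term 1 is cancelled degree by degree, over any commutative ring. This
    stands in for division by Euler products. *)
Lemma fps_cancel f g h : f 0%N = 1 -> f * g = f * h -> g = h.
Proof.
move=> f1 /eqP; rewrite -subr_eq0 -mulrBr => /eqP fgh.
apply/eqP; rewrite -subr_eq0; apply/eqP; move: (g - h) fgh => {h}g fg0.
apply: fpsP => n; elim/ltn_ind: n => n IHn.
have := congr1 (fun f : fps R => f n) fg0.
rewrite coef_fpsM big_ord_recl f1 mul1r subn0 big1 ?addr0 // => i _.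
by rewrite IHn ?mulr0 //= /bump /=; have := ltn_ord i; lia.
Qed.

(** Congruence modulo q^N. Identities between infinite sums and products are proved modulo every
    power of q, from finite versions. *)
Definition eqm N f g := forall i, (i < N)%N -> f i = g i.

Lemma eqm_sym N f g : eqm N f g -> eqm N g f.
Proof. by move=> fg i iN; rewrite fg. Qed.
Lemma eqm_trans N g f h : eqm N f g -> eqm N g h -> eqm N f h.
Proof. by move=> fg gh i iN; rewrite fg ?gh. Qed.
Lemma eqm_le M N f g : (N <= M)%N -> eqm M f g -> eqm N f g.
Proof. by move=> leNM fg i iN; apply: fg; apply: leq_trans leNM. Qed.
Lemma eqmP f g : (forall N, eqm N f g) -> f = g.
Proof. by move=> fg; apply: fpsP => n; apply: (fg n.+1). Qed.
Lemma eqmD N f f' g g' : eqm N f f' -> eqm N g g' -> eqm N (f + g) (f' + g').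
Proof. by move=> ff gg i iN; rewrite !coef_fpsD ff ?gg. Qed.
Lemma eqmN N f f' : eqm N f f' -> eqm N (- f) (- f').
Proof. by move=> ff i iN; rewrite !coef_fpsN ff. Qed.
Lemma eqmM N f f' g g' : eqm N f f' -> eqm N g g' -> eqm N (f * g) (f' * g').
Proof.
move=> ff gg i iN; rewrite !coef_fpsM; apply: eq_bigr => j _.
by rewrite ff ?gg //; have := ltn_ord j; lia.
Qed.
Lemma eqmX N f f' k : eqm N f f' -> eqm N (f ^+ k) (f' ^+ k).
Proof. by move=> ff; elim: k => [|k IHk] //; rewrite !exprS; apply: eqmM. Qed.
Lemma eqm_sum N (I : Type) (r : seq I) (P : pred I) (F G : I -> fps R) :
  (forall i, P i -> eqm N (F i) (G i)) ->
  eqm N (\sum_(i <- r | P i) F i) (\sum_(i <- r | P i) G i).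
Proof. by move=> FG; elim/big_ind2: _ => // *; apply: eqmD. Qed.

Lemma eqm0M a b f g : eqm a f 0 -> eqm b g 0 -> eqm (a + b) (f * g) 0.
Proof.
move=> f0 g0 n nab; rewrite coef_fpsM big1 // => i _.
case: (ltnP i a) => [/f0->|]; first by rewrite mul0r.
by move=> ai; rewrite g0 ?mulr0 //; have := ltn_ord i; lia.
Qed.

Lemma eqm_Xn0 k : eqm k (fpsX ^+ k) 0.
Proof. by move=> i ik; rewrite coef_fpsXn ltn_eqF. Qed.

Lemma eqm_cancel N f g h : f 0%N = 1 -> eqm N (f * g) (f * h) -> eqm N g h.
Proof.
move=> f1 fgh n; elim/ltn_ind: n => n IHn nN.
have := fgh n nN; rewrite !coef_fpsM !big_ord_recl f1 !mul1r subn0 /=.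
set s := \sum_(i < n) _; set t := \sum_(i < n) _.
suff -> : s = t by move/addIr.
apply: eq_bigr => i _; congr (_ * _); have := ltn_ord i => lin.
by apply: IHn; rewrite /bump /=; lia.
Qed.

(** * The substitution q -> q^d, the twist q -> wq, and constants *)

Fact fps_sub_is_zmod_morphism d : zmod_morphism (@fps_sub R d).
Proof.
move=> f g; apply: fpsP => n; rewrite coef_fpsB !coef_fps_sub coef_fpsB.
by case: ifP => _ //; rewrite subr0.
Qed.

Lemma coef_fps_sub_trunc N d f n : (0 < d)%N -> (n < N)%N ->
  fps_sub d f n = (fps_trunc N f \Po 'X^d)`_n.
Proof.
move=> d_gt0 nN; rewrite coef_fps_sub coef_comp_poly_Xn //; case: ifP => // dn.
by rewrite coef_fps_trunc //; apply: leq_ltn_trans (leq_div _ _) nN.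
Qed.

Fact fps_sub_is_monoid_morphism d : monoid_morphism (@fps_sub R d).
Proof.
have [->|d_gt0] := posnP d.
  split=> [|f g]; apply: fpsP => -[|n]; rewrite coef_fps_sub ?coef_fps1 ?coef_fpsM //=.
    by rewrite !big_ord1 !coef_fps_sub.
  by rewrite big1 // => i _; rewrite !coef_fps_sub;
     case: (i : nat) => [|k]; rewrite ?mul0r // subn0 mulr0.
split=> [|f g]; apply: fpsP => n.
  rewrite [RHS]coef_fps1 coef_fps_sub; have [->|n0] := eqVneq n 0%N.
    by rewrite dvdn0 div0n.
  by case: ifP => // /divnK nd; rewrite -nd in n0; case: (n %/ d)%N n0.
rewrite (@coef_fps_sub_trunc n.+1) // (@coef_fpsM_trunc n.+1) //.
transitivity ((fps_trunc n.+1 f \Po 'X^d) * (fps_trunc n.+1 g \Po 'X^d))`_n.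
  rewrite -comp_polyM !coef_comp_poly_Xn //; case: ifP => // dn.
  have ltn : (n %/ d < n.+1)%N by rewrite ltnS leq_div.
  by rewrite coef_fps_trunc // -coef_fpsM_trunc.
rewrite !coefM; apply: eq_bigr => i _; have lin := ltn_ord i.
by rewrite -!(@coef_fps_sub_trunc n.+1) ?coef_fps_trunc //; lia.
Qed.

HB.instance Definition _ d := GRing.isZmodMorphism.Build
  (fps R) (fps R) (fps_sub d) (fps_sub_is_zmod_morphism d).
HB.instance Definition _ d := GRing.isMonoidMorphism.Build
  (fps R) (fps R) (fps_sub d) (fps_sub_is_monoid_morphism d).

Lemma fps_subX d : (0 < d)%N -> fps_sub d fpsX = fpsX ^+ d.
Proof.
move=> d_gt0; apply: fpsP => n; rewrite coef_fps_sub coef_fpsXn /=.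
have [->|nd] := eqVneq n d; first by rewrite dvdnn divnn d_gt0.
by case: ifP => // /divnK dn; case: eqP => // n1; rewrite n1 mul1n in dn;
   rewrite dn eqxx in nd.
Qed.

Lemma fps_subXn d k : (0 < d)%N -> fps_sub d (fpsX ^+ k) = fpsX ^+ (d * k).
Proof. by move=> d_gt0; rewrite rmorphXn /= fps_subX // exprM. Qed.

Lemma fps_sub_sub c d f : (0 < d)%N ->
  fps_sub c (fps_sub d f) = fps_sub (c * d) f.
Proof.
move=> d_gt0; apply: fpsP => n; rewrite !coef_fps_sub.
have [->|c_gt0] := posnP c.
  rewrite mul0n dvd0n; case: eqP => // ->.
  by rewrite !div0n dvdn0.
case: (boolP (c %| n)%N) => [/dvdnP[k ->]|ncn].
  rewrite mulnK // [(k * c)%N]mulnC dvdn_pmul2l //; case: ifP => // _.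
  by rewrite divnMl.
case: ifP => // /dvdnP[k nk]; case/negP: ncn.
by rewrite nk mulnCA dvdn_mulr.
Qed.

Lemma eqm_sub N d f g : (0 < d)%N -> eqm N f g ->
  eqm N (fps_sub d f) (fps_sub d g).
Proof.
move=> d_gt0 fg n nN; rewrite !coef_fps_sub; case: ifP => // _.
by apply: fg; apply: leq_ltn_trans (leq_div _ _) nN.
Qed.

(** Allows an identity in q to be checked in q^d, where the pieces of a d-dissection occur. *)
Lemma fps_sub_inj d : (0 < d)%N -> injective (@fps_sub R d).
Proof.
move=> d_gt0 f g fg; apply: fpsP => n.
have := congr1 (fun f : fps R => f (n * d)%N) fg.
by rewrite !coef_fps_sub dvdn_mull // mulnK.
Qed.

Lemma coef0_sub d f : fps_sub d f 0%N = f 0%N.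
Proof. by rewrite coef_fps_sub dvdn0 div0n. Qed.

Fact fps_tw_is_zmod_morphism w : zmod_morphism (fps_tw w).
Proof. by move=> f g; apply: fpsP => n; rewrite coef_fpsB !coef_fps_tw -mulrBr. Qed.
Fact fps_tw_is_monoid_morphism w : monoid_morphism (fps_tw w).
Proof.
split=> [|f g]; apply: fpsP => n.
  by rewrite coef_fps_tw coef_fps1; case: n => [|n]; rewrite ?mulr0 ?mul1r.
rewrite coef_fps_tw !coef_fpsM big_distrr /=; apply: eq_bigr => i _.
rewrite !coef_fps_tw.
have -> : w ^+ n = w ^+ i * w ^+ (n - i) by rewrite -exprD subnKC // -ltnS.
by ring.
Qed.

HB.instance Definition _ w := GRing.isZmodMorphism.Build
  (fps R) (fps R) (fps_tw w) (fps_tw_is_zmod_morphism w).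
HB.instance Definition _ w := GRing.isMonoidMorphism.Build
  (fps R) (fps R) (fps_tw w) (fps_tw_is_monoid_morphism w).

Definition fpsC (c : R) : fps R := Fps (fun n => if n is 0 then c else 0).

Lemma coef_fpsCM c f n : (fpsC c * f) n = c * f n.
Proof.
rewrite coef_fpsM big_ord_recl /= subn0 big1 ?addr0 // => i _.
by rewrite mul0r.
Qed.

Fact fpsC_is_zmod_morphism : zmod_morphism fpsC.
Proof. by move=> a b; apply: fpsP => -[|n]; rewrite coef_fpsB //= subr0. Qed.
Fact fpsC_is_monoid_morphism : monoid_morphism fpsC.
Proof.
split=> [|a b]; apply: fpsP => n; first by case: n.
by rewrite coef_fpsCM; case: n => [|n] //=; rewrite mulr0.
Qed.
HB.instance Definition _ := GRing.isZmodMorphism.Build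
  R (fps R) fpsC fpsC_is_zmod_morphism.
HB.instance Definition _ := GRing.isMonoidMorphism.Build
  R (fps R) fpsC fpsC_is_monoid_morphism.

Lemma fps_twX w : fps_tw w fpsX = fpsC w * fpsX.
Proof.
apply: fpsP => n; rewrite coef_fpsCM coef_fps_tw.
by case: n => [|[|n]]; rewrite ?mulr0 ?expr1.
Qed.

Lemma fps_tw_sub w d f : w ^+ d = 1 -> fps_tw w (fps_sub d f) = fps_sub d f.
Proof.
move=> wd; apply: fpsP => n; rewrite coef_fps_tw coef_fps_sub.
case: ifP => [/dvdnP[k ->]|]; last by rewrite mulr0.
by rewrite mulnC exprM wd expr1n mul1r.
Qed.

Lemma eqm_tw N w f g : eqm N f g -> eqm N (fps_tw w f) (fps_tw w g).
Proof. by move=> fg n nN; rewrite !coef_fps_tw fg. Qed.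

End PowerSeries.

(** * The finite triple product *)

Section FiniteTripleProduct.

Variables (A : comNzRingType) (Q : A).

(** The finite q-Pochhammer symbol (Q; Q)_m. *)
Definition qfact m : A := \prod_(i < m) (1 - Q ^+ i.+1).

Lemma qfact0 : qfact 0 = 1. Proof. by rewrite /qfact big_ord0. Qed.
Lemma qfactS m : qfact m.+1 = qfact m * (1 - Q ^+ m.+1).
Proof. by rewrite /qfact big_ord_recr. Qed.

(* [gbin n j] is the Gaussian binomial [2n+1; n-j]_Q, and 0 for n < j. *)
Fixpoint gbin n j : A :=
  if n is n'.+1 then
    if j is j'.+1 then
      (1 + Q ^+ (2 * n').+2) * gbin n' j + Q ^+ (n' - j') * gbin n' j'
      + Q ^+ (n' + j').+3 * gbin n' j.+1
    else (1 + Q ^+ (2 * n').+2 + Q ^+ n'.+1) * gbin n' 0%N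
         + Q ^+ n'.+2 * gbin n' 1%N
  else (j == 0)%:R.

Lemma gbin_small n j : (n < j)%N -> gbin n j = 0.
Proof.
elim: n j => [|n IHn] [|j] //= ltnj.
by rewrite !IHn ?mulr0 ?addr0 //; lia.
Qed.

(** The quotient formula for the Gaussian binomial with denominators cleared, since [A] has no
    division. Each step puts the terms of the recurrence over a common denominator. *)
Lemma gbin_qfact n j : (j <= n)%N ->
  gbin n j * (qfact (n - j) * qfact (n + j).+1) = qfact (2 * n).+1.
Proof.
elim: n j => [|n IHn] j.
  by rewrite leqn0 => /eqP ->; rewrite qfact0 !mul1r.
(* Adapts the induction hypothesis to the first denominator of rank n+1. At k = n+1, which the
   recurrence also reaches, both sides are 0. *)
have step1 k : (k <= n.+1)%N ->
    gbin n k * (qfact (n.+1 - k) * qfact (n + k).+1)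
    = qfact (2 * n).+1 * (1 - Q ^+ (n.+1 - k)).
  rewrite leq_eqVlt => /predU1P[->|]; last rewrite ltnS => lekn.
    by rewrite gbin_small // subnn subrr mul0r mulr0.
  by rewrite subSn // qfactS -(IHn k) //; ring.
have -> : (2 * n.+1).+1 = (2 * n).+3 by lia.
case: j => [_|j lejn] /=.
  have e1 := step1 0%N isT; rewrite subn0 addn0 in e1.
  have e2 : gbin n 1 * (qfact n.+1 * qfact n.+2)
      = qfact (2 * n).+1 * (1 - Q ^+ n) * (1 - Q ^+ n.+1).
    have := step1 1%N isT; rewrite subSS subn0 addn1 => e2.
    by rewrite -e2 qfactS; ring.
  rewrite subn0 addn0.
  have e0 : gbin n 0 * (qfact n.+1 * qfact n.+2) =
     qfact (2 * n).+1 * (1 - Q ^+ n.+1) * (1 - Q ^+ n.+2).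
    by rewrite -e1 [qfact n.+2]qfactS; ring.
  rewrite [LHS](_ : _ = (1 + Q ^+ (2 * n).+2 + Q ^+ n.+1) *
    (gbin n 0 * (qfact n.+1 * qfact n.+2)) +
    Q ^+ n.+2 * (gbin n 1 * (qfact n.+1 * qfact n.+2))); last by ring.
  rewrite e0 e2 [qfact (2 * n).+3]qfactS [qfact (2 * n).+2]qfactS !exprS.
  have -> : Q ^+ (2 * n) = Q ^+ n * Q ^+ n by rewrite -exprD; congr (_ ^+ _); lia.
  by ring.
rewrite ltnS in lejn; rewrite subSS.
(* [e1], [e2] and [e3] put the three binomials of the recurrence over
   [qfact (n - j) * qfact (n + j).+3]. *)
have e1 : gbin n j * (qfact (n - j) * qfact (n + j).+3)
    = qfact (2 * n).+1 * (1 - Q ^+ (n + j).+2) * (1 - Q ^+ (n + j).+3).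
  by rewrite -(IHn j) // !qfactS; ring.
have e2 : gbin n j.+1 * (qfact (n - j) * qfact (n + j).+3)
    = qfact (2 * n).+1 * (1 - Q ^+ (n - j)) * (1 - Q ^+ (n + j).+3).
  have := step1 j.+1; rewrite subSS addnS => e2.
  by rewrite -e2 // [qfact (_ + _).+3]qfactS; ring.
have e3 : gbin n j.+2 * (qfact (n - j) * qfact (n + j).+3)
    = qfact (2 * n).+1 * (1 - Q ^+ (n - j)) * (1 - Q ^+ (n - j).-1).
  (* For j = n the truncated predecessor is harmless: the factor [1 - Q ^+ (n - j)] is already 0. *)
  have [->|ltjn] := eqVneq j n.
    by rewrite gbin_small // subnn subrr mulr0 !mul0r.
  have ltj : (j < n)%N by lia.
  have := step1 j.+2 ltj; rewrite subSS !addnS => e3.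
  have -> : (n - j)%N = (n - j.+1).+1 by lia.
  transitivity (qfact (2 * n).+1 * (1 - Q ^+ (n - j.+1))
                * (1 - Q ^+ (n - j.+1).+1)); last by rewrite /=; ring.
  by rewrite -e3 qfactS; ring.
have -> : (n.+1 + j.+1).+1 = (n + j).+3 by lia.
rewrite [LHS](_ : _ = (1 + Q ^+ (2 * n).+2) *
    (gbin n j.+1 * (qfact (n - j) * qfact (n + j).+3)) +
    Q ^+ (n - j) * (gbin n j * (qfact (n - j) * qfact (n + j).+3)) +
    Q ^+ (n + j).+3 * (gbin n j.+2 * (qfact (n - j) * qfact (n + j).+3)));
  last by ring.
rewrite e1 e2 e3.
rewrite [qfact (2 * n).+3]qfactS [qfact (2 * n).+2]qfactS -mulrA.
have := lejn; rewrite leq_eqVlt => /predU1P[<-|ltj].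
  rewrite subnn subrr expr0 !(mulr0, mul0r).
  have -> : (2 * j = j + j)%N by lia.
  by ring.
(* Writing n = j + k + 1 turns truncated differences of exponents into sums, which [ring] can
   handle. *)
have [k ->] : exists k, n = (j + k).+1 by exists (n - j.+1)%N; lia.
have -> : ((j + k).+1 - j = k.+1)%N by lia.
have -> : (2 * (j + k).+1 = j + j + k + k + 2)%N by lia.
have -> : (((j + k).+1 + j) = j + j + k + 1)%N by lia.
rewrite /= !exprS !exprD !exprS expr0; ring.
Qed.

(* The summation index k of the bilateral theta sum is folded along
   k <-> -1-k, which exchanges the two equal binomials. *)
Lemma finite_triple_product (v : nat -> A) (mu : A) n :
  (forall j, v j.+1 + Q ^+ (2 * j).+1 * v j.-1 = Q ^+ j * mu * v j) ->
  \sum_(j < n.+1) gbin n j * v j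
  = v 0%N * \prod_(i < n) (1 + Q ^+ (2 * i).+2 + Q ^+ i * mu).
Proof.
(* At j = 0 the hypothesis reads [v 1 + Q * v 0 = mu * v 0], because [0.-1 = 0]: the folding
   identifies the index -1 with 0. *)
move=> vrec; elim: n => [|n IHn].
  by rewrite big_ord_recl !big_ord0 /= mul1r addr0 mulr1.
rewrite [in RHS]big_ord_recr mulrA -IHn big_distrl /=.
have sum2 (F : nat -> A) : \sum_(j < n.+1) gbin n j * F j
    = \sum_(j < n.+3) gbin n j * F j.
  rewrite [in RHS]big_ord_recr [in RHS]big_ord_recr /=.
  by rewrite (@gbin_small n n.+1) // (@gbin_small n n.+2) // !mul0r !addr0.
have sum1 (F : nat -> A) : \sum_(j < n.+1) gbin n j * F j
    = \sum_(j < n.+2) gbin n j * F j.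
  by rewrite [in RHS]big_ord_recr /= (@gbin_small n n.+1) // mul0r addr0.
(* Regroups the sum of rank n+1 by binomials of rank n: [gbin n j] collects multiples of [v j],
   [v j.+1] and [v j.-1], which [vrec] combines into the new factor times [v j]. *)
transitivity (\sum_(j < n.+1) gbin n j * ((1 + Q ^+ (2 * n).+2) * v j)
  + \sum_(j < n.+1) gbin n j * (Q ^+ (n - j) * v j.+1)
  + \sum_(j < n.+1) gbin n j * (Q ^+ (n + j).+1 * v j.-1)).
  rewrite [in RHS](sum2 (fun j => Q ^+ (n + j).+1 * v j.-1)).
  rewrite [in RHS](sum1 (fun j => (1 + Q ^+ (2 * n).+2) * v j)).
  rewrite big_ord_recl /= ![\sum_(j < n.+2) _]big_ord_recl /=.
  rewrite [\sum_(j < n.+3) _]big_ord_recl [\sum_(i < n.+2) _]big_ord_recl /=.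
  rewrite [\sum_(j < n.+1) _](eq_bigr (fun j : 'I_n.+1 =>
    gbin n j.+1 * ((1 + Q ^+ (2 * n).+2) * v j.+1)
    + gbin n j * (Q ^+ (n - j) * v j.+1)
    + gbin n j.+2 * (Q ^+ (n + j).+3 * v j.+1))) => [|j _]; last first.
    by rewrite /bump /= add1n; ring.
  rewrite !big_split /=.
  have -> : \sum_(i < n.+1) gbin n (bump 0 (bump 0 i)) *
      (Q ^+ (n + bump 0 (bump 0 i)).+1 * v (0 + bump 0 i)%N)
    = \sum_(i < n.+1) gbin n i.+2 * (Q ^+ (n + i).+3 * v i.+1).
    by apply: eq_bigr => i _; rewrite /bump /= !add1n !addnS.
  have -> : \sum_(i < n.+1) gbin n (bump 0 i) *
      ((1 + Q ^+ (2 * n).+2) * v (bump 0 i))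
    = \sum_(i < n.+1) gbin n i.+1 * ((1 + Q ^+ (2 * n).+2) * v i.+1) by [].
  by rewrite addn0 addn1 /bump /=; ring.
rewrite -!big_split; apply: eq_bigr => j _ /=.
have lejn : (j <= n)%N by rewrite -ltnS.
have -> : Q ^+ (n + j).+1 = Q ^+ (n - j) * Q ^+ (2 * j).+1.
  by rewrite -exprD; congr (_ ^+ _); lia.
have -> : Q ^+ n * mu = Q ^+ (n - j) * (Q ^+ j * mu).
  by rewrite mulrA -exprD subnK.
have vj := vrec j.
transitivity (gbin n j * ((1 + Q ^+ (2 * n).+2) * v j + Q ^+ (n - j) *
   (v j.+1 + Q ^+ (2 * j).+1 * v j.-1))); first by ring.
by rewrite vj; ring.
Qed.

End FiniteTripleProduct.

(** * Euler's product and theta series *)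

(** The infinite product E_d. For d > 0 the factors after the n-th are 1 modulo q^(n+1), so
    coefficient n is that of the n-th partial product. *)
HB.lock Definition euler (R : comNzRingType) d : fps R :=
  Fps (fun n => qfact (fpsX R ^+ d) n n).

(** Meant for families with [v m] divisible by q^m, where coefficient n depends on the first n+1
    terms only. *)
HB.lock Definition fps_sum (R : comNzRingType) (v : nat -> fps R) : fps R :=
  Fps (fun n => (\sum_(m < n.+1) v m) n).

Section EulerProduct.

Variable R : comNzRingType.
Notation X := (fpsX R).
Notation euler := (@euler R).
Implicit Types (f g : fps R) (v : nat -> fps R).

Lemma eqm_euler d n : (0 < d)%N -> eqm n.+1 (euler d) (qfact (X ^+ d) n).
Proof.
move=> d_gt0 i; rewrite euler.unlock ltnS => /subnK <-; elim: (n - i)%N => [|k IHk] //.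
rewrite addSn qfactS IHk mulrBr mulr1 coef_fpsB; apply/eqP.
rewrite -subr_eq0 opprB addrC subrK -exprM; apply/eqP.
have ltik : (i < 0 + d * (k + i).+1)%N by nia.
by apply: (@eqm0M _ 0 _ _ _ _ _ _ ltik) => //; apply: eqm_Xn0.
Qed.

Lemma coef_euler0 d : euler d 0%N = 1.
Proof. by rewrite euler.unlock /= qfact0 coef_fps1. Qed.

Lemma fps_sub_euler c d : (0 < c)%N -> (0 < d)%N ->
  fps_sub c (euler d) = euler (c * d).
Proof.
move=> c_gt0 d_gt0; apply: eqmP => N.
apply: (@eqm_trans _ _ (qfact (X ^+ (c * d)) N)); last first.
  by apply/eqm_sym/(eqm_le (leqnSn N))/eqm_euler; rewrite muln_gt0 c_gt0.
have -> : qfact (X ^+ (c * d)) N = fps_sub c (qfact (X ^+ d) N).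
  rewrite /qfact rmorph_prod; apply: eq_bigr => i _.
  by rewrite rmorphB rmorph1 rmorphXn /= fps_subXn.
by apply: eqm_sub => //; apply: (eqm_le (leqnSn N)); apply: eqm_euler.
Qed.

Lemma eqm_fps_sum v N : (forall m, eqm m (v m) 0) ->
  eqm N (fps_sum v) (\sum_(m < N) v m).
Proof.
move=> v0 n; rewrite fps_sum.unlock => /subnK <-; elim: (N - n.+1)%N => [|k IHk] //.
by rewrite addSn big_ord_recr coef_fpsD /= v0 ?addr0 // leq_addl.
Qed.

(** The limit of the finite identity: E_d times [gbin n j] is 1 modulo q^(n-j+1), and [v j] is
    divisible by q^j, so their product is [v j] modulo q^(n+1). *)
Lemma eqm_triple_product v mu d n : (0 < d)%N ->
  (forall m, eqm m (v m) 0) ->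
  (forall j, v j.+1 + X ^+ (d * (2 * j).+1) * v j.-1 = X ^+ (d * j) * mu * v j) ->
  eqm n.+1 (fps_sum v) (euler d *
    (v 0%N * \prod_(i < n) (1 + X ^+ (d * (2 * i).+2) + X ^+ (d * i) * mu))).
Proof.
move=> d_gt0 v0 vrec; set p := v 0%N * _.
have -> : p = \sum_(j < n.+1) gbin (X ^+ d) n j * v j.
  rewrite (@finite_triple_product _ _ _ mu) => [|j]; last by rewrite -!exprM.
  by congr (_ * _); apply: eq_bigr => i _; rewrite -!exprM.
apply: eqm_trans (@eqm_fps_sum v n.+1 v0) _; rewrite big_distrr /=.
apply: eqm_sum => j _; have lejn : (j <= n)%N by rewrite -ltnS.
(* To this precision the three [qfact] of [gbin_qfact] all equal E_d; the claim follows after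
   cancelling E_d^2. *)
have Egbin : eqm (n - j).+1 (euler d * gbin (X ^+ d) n j) 1.
  set k := (n - j)%N.
  have Eq m : (k <= m)%N -> eqm k.+1 (qfact (X ^+ d) m) (euler d).
    by move=> lekm; apply: (@eqm_le _ m.+1); rewrite ?ltnS //;
       apply/eqm_sym/eqm_euler.
  apply: (@eqm_cancel _ _ (euler d * euler d)).
    by rewrite coef_fpsM0 !coef_euler0 mulr1.
  have := gbin_qfact (X ^+ d) lejn => /(congr1 (fun f => euler d * f)) bE.
  apply: (@eqm_trans _ _ (euler d * gbin (X ^+ d) n j *
     (qfact (X ^+ d) (n - j) * qfact (X ^+ d) (n + j).+1))).
    rewrite mulrC; apply: eqmM => //; apply: eqmM; apply/eqm_sym/Eq => //.
    by rewrite /k; lia.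
  rewrite -mulrA bE mulr1; apply: eqmM => //; apply: Eq.
  by rewrite /k; lia.
move=> i ltin; apply/eqP; rewrite mulrA -[in X in X == _](mul1r (v j)).
rewrite -subr_eq0 -coef_fpsB -mulrBl; apply/eqP.
apply: (@eqm0M _ (n - j).+1 j); [|exact: v0|lia].
by move=> l ltl; rewrite coef_fpsB Egbin // subrr.
Qed.

Definition tri j := 'C(j.+1, 2).
Lemma tri0 : tri 0 = 0%N. Proof. by []. Qed.
Lemma triS j : tri j.+1 = (tri j + j.+1)%N.
Proof. by rewrite /tri binS bin1. Qed.
Lemma tri_ge j : (j <= tri j)%N.
Proof. by elim: j => // j IHj; rewrite triS; lia. Qed.

Definition jacobi_term j : fps R := (-1) ^+ j * (2 * j).+1%:R * X ^+ tri j.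
Definition psi_term j : fps R := X ^+ tri j.
(** The terms of the alternating series of squares at the integers j and -1-j, paired to fit the
    folded triple product. *)
Definition phi_term j : fps R :=
  (-1) ^+ j * (X ^+ (j * j) - X ^+ (j.+1 * j.+1)).

Definition psi := fps_sum psi_term.
Definition phi := fps_sum phi_term.

Lemma eqm_MXn0 f k m : (m <= k)%N -> eqm m (f * X ^+ k) 0.
Proof.
move=> lemk; apply: (@eqm_le _ (0 + k)) => //.
by apply: eqm0M => //; apply: eqm_Xn0.
Qed.

Lemma eqm_jacobi_term j : eqm j (jacobi_term j) 0.
Proof. by apply: eqm_MXn0; apply: tri_ge. Qed.

Lemma eqm_psi_term j : eqm j (psi_term j) 0.
Proof. by rewrite -[psi_term j]mul1r; apply: eqm_MXn0; apply: tri_ge. Qed.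

Lemma eqm_phi_term j : eqm j (phi_term j) 0.
Proof.
move=> i lti; rewrite /phi_term mulrBr coef_fpsB.
by rewrite !(@eqm_MXn0 _ _ j) // ?subrr //; nia.
Qed.

(** With [mu] = -2q every factor of the triple product is a square (1 - q^(i+1))^2. *)
Theorem jacobi_cube : fps_sum jacobi_term = euler 1 ^+ 3.
Proof.
apply: eqmP => N; apply: (eqm_le (leqnSn N)).
apply: eqm_trans (@eqm_triple_product _ (- 2%:R * X) 1 N isT eqm_jacobi_term _) _.
  case=> [|j]; rewrite /jacobi_term !triS ?tri0 !mul1n /=.
    by rewrite !exprS !expr0; ring.
  have -> : ((2 * j.+1).+1 = j + j + 3)%N by lia.
  have -> : ((2 * j.+2).+1 = j + j + 5)%N by lia.
  have -> : ((2 * j).+1 = j + j + 1)%N by lia.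
  by rewrite !exprS !exprD !exprS !natrD; ring.
rewrite exprS; apply: eqmM => //.
set p := _ * _; have -> : p = qfact (X ^+ 1) N ^+ 2.
  rewrite /p /jacobi_term tri0 !mul1r /qfact -prodrXl.
  apply: eq_bigr => i _; rewrite expr1 !mul1n.
  have -> : (2 * i).+2 = (i.+1 + i.+1)%N by lia.
  by rewrite exprD !exprS; ring.
by apply/eqmX/eqm_sym/eqm_euler.
Qed.

(** With [mu] = 2q the factors are (1 + q^(i+1))^2, and multiplying by E_1 twice makes them (1 -
    q^(2i+2))^2. *)
Theorem psi_euler : psi * euler 1 = euler 2 ^+ 2.
Proof.
apply: eqmP => N; apply: (eqm_le (leqnSn N)).
apply: (@eqm_trans _ _ (euler 1 * (\prod_(i < N) (1 + X ^+ i.+1) ^+ 2) * euler 1)).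
  apply: eqmM => //.
  apply: eqm_trans (@eqm_triple_product _ (2%:R * X) 1 N isT eqm_psi_term _) _.
    case=> [|j]; rewrite /psi_term !triS ?tri0 !mul1n /=.
      by rewrite !exprS !expr0; ring.
    have -> : (2 * j.+1 = j + j + 2)%N by lia.
    by rewrite !exprD !exprS ?exprD; ring.
  apply: eqmM => //; rewrite /psi_term tri0 mul1r.
  move=> k _; congr coefs; apply: eq_bigr => i _; rewrite !mul1n.
  have -> : (2 * i).+2 = (i.+1 + i.+1)%N by lia.
  by rewrite exprD !exprS; ring.
apply: (@eqm_trans _ _ ((qfact (X ^+ 1) N * \prod_(i < N) (1 + X ^+ i.+1)) ^+ 2)).
  rewrite exprMn prodrXl mulrC mulrA -expr2; apply: eqmM => //.
  exact/eqmX/eqm_euler.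
have -> : qfact (X ^+ 1) N * \prod_(i < N) (1 + X ^+ i.+1) = qfact (X ^+ 2) N.
  rewrite /qfact -big_split; apply: eq_bigr => i _ /=.
  by rewrite -!exprM mul1n mulSn mul1n exprD; ring.
by apply/eqmX/eqm_sym/eqm_euler.
Qed.

(** In base q^2 with [mu] = -q - q^3 each factor splits as (1 - q^(2i+1))(1 - q^(2i+3)); with the
    initial term 1 - q this gives two products over odd exponents. *)
Theorem phi_euler : phi * euler 2 = euler 1 ^+ 2.
Proof.
apply: eqmP => N; apply: (eqm_le (leqnSn N)).
pose odds n := \prod_(i < n) (1 - X ^+ (2 * i).+1).
have odds2 n : odds n * qfact (X ^+ 2) n = qfact X (2 * n).
  elim: n => [|n IHn]; first by rewrite /odds big_ord0 !qfact0 mulr1.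
  have -> : (2 * n.+1 = (2 * n).+2)%N by lia.
  rewrite /odds big_ord_recr /= -/(odds n) !qfactS -IHn -exprM.
  have -> : (2 * n.+1 = (2 * n).+2)%N by lia.
  by ring.
apply: (@eqm_trans _ _ (euler 2 * (odds N * odds N.+1) * euler 2)).
  apply: eqmM => //.
  apply: eqm_trans (@eqm_triple_product _ (- X - X ^+ 3) 2 N isT eqm_phi_term _) _.
    case=> [|j]; rewrite /phi_term /=; first by rewrite !exprS !expr0; ring.
    have -> : (j.+2 * j.+2 = j * j + 4 * j + 4)%N by lia.
    have -> : (j.+3 * j.+3 = j * j + 6 * j + 9)%N by lia.
    have -> : (j.+1 * j.+1 = j * j + 2 * j + 1)%N by lia.
    have -> : (2 * (2 * j.+1).+1 = 4 * j + 6)%N by lia.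
    have -> : (2 * j.+1 = 2 * j + 2)%N by lia.
    by rewrite !exprS !exprD; ring.
  apply: eqmM => // k _; congr coefs.
  rewrite /odds [in RHS]big_ord_recl mulrCA -big_split /phi_term /=.
  congr (_ * _); first by rewrite !expr0 expr1 mul1r.
  apply: eq_bigr => i _; rewrite /bump /= add1n.
  have -> : (2 * (2 * i).+2 = 2 * i + 2 * i + 4)%N by lia.
  have -> : ((2 * i.+1).+1 = 2 * i + 3)%N by lia.
  by rewrite !exprS !exprD; ring.
have E1 n m : (N <= n)%N -> (N <= m)%N -> eqm N.+1 (qfact X n) (qfact X m).
  rewrite -ltnS => len; rewrite -ltnS => lem.
  have := @eqm_euler 1 n isT; rewrite expr1 => /(eqm_le len)/eqm_sym En.
  have := @eqm_euler 1 m isT; rewrite expr1 => /(eqm_le lem).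
  exact: eqm_trans.
have -> : euler 2 * (odds N * odds N.+1) * euler 2
  = (odds N * euler 2) * (odds N.+1 * euler 2) by ring.
rewrite expr2; apply: eqmM.
  apply: (@eqm_trans _ _ (odds N * qfact (X ^+ 2) N)).
    by apply: eqmM => //; apply: eqm_euler.
  rewrite odds2; apply: (@eqm_trans _ _ (qfact X N)); first by apply: E1; lia.
  by apply: eqm_sym; have := @eqm_euler 1 N isT; rewrite expr1.
apply: (@eqm_trans _ _ (odds N.+1 * qfact (X ^+ 2) N.+1)).
  by apply: eqmM => //; apply: (@eqm_le _ N.+2) => //; apply: eqm_euler.
rewrite odds2; apply: (@eqm_trans _ _ (qfact X N)); first by apply: E1; lia.
by apply: eqm_sym; have := @eqm_euler 1 N isT; rewrite expr1.
Qed.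

End EulerProduct.

(** * Hecke relations for tau *)

Section Hecke.

Variable R : comNzRingType.
Notation X := (fpsX R).
Notation E := (@euler R).
Implicit Types (f g : fps R).

(** * Twisted Euler products, theta identities and the Hecke relation at 2 *)

Lemma fps_twXn (w : R) k : fps_tw w (X ^+ k) = fpsC w ^+ k * X ^+ k.
Proof. by rewrite rmorphXn /= fps_twX exprMn. Qed.

Lemma tw_euler w c d : w ^+ c = 1 -> (0 < c)%N -> (0 < d)%N ->
  fps_tw w (E (c * d)) = E (c * d).
Proof. by move=> wc c_gt0 d_gt0; rewrite -fps_sub_euler // fps_tw_sub. Qed.

Lemma eqm_euler1 n : eqm n.+1 (E 1) (qfact X n).
Proof. by have := @eqm_euler R 1 n isT; rewrite expr1. Qed.

(** In E_1(q) E_1(-q) the factors of odd index k give 1 - q^(2k), with product E_2/E_4, and those of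
    even index give E_2^2. *)
Lemma euler_norm2 : E 1 * fps_tw (-1) (E 1) * E 4 = E 2 ^+ 3.
Proof.
have fin N : qfact X (2 * N) * fps_tw (-1) (qfact X (2 * N)) * qfact (X ^+ 4) N
    = qfact (X ^+ 2) (2 * N) * qfact (X ^+ 2) N ^+ 2.
  elim: N => [|N IHN]; first by rewrite muln0 !qfact0 rmorph1 expr1n !mulr1.
  have -> : (2 * N.+1 = (2 * N).+2)%N by lia.
  have twX k : fps_tw (-1) (X ^+ k) = (-1) ^+ k * X ^+ k.
    by rewrite fps_twXn rmorphN1.
  rewrite !qfactS !rmorphM /= !rmorphB !rmorph1 /= !twX.
  have sgn k : (-1) ^+ (2 * k) = 1 :> fps R by rewrite exprM sqrrN expr1n expr1n.
  rewrite ![(-1) ^+ _.+1]exprS sgn mulr1 mulrNN mulr1 mul1r mulN1r opprK.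
  set x1 := X ^+ (2 * N).+1; set x2 := X ^+ (2 * N).+2.
  have Xc k : (X ^+ 2) ^+ k = (X ^+ k) ^+ 2 by rewrite -!exprM mulnC.
  have -> : (X ^+ 4) ^+ N.+1 = x2 ^+ 2.
    by rewrite /x2 -!exprM; congr (_ ^+ _); lia.
  have -> : (X ^+ 2) ^+ N.+1 = x2 by rewrite /x2 -!exprM; congr (_ ^+ _); lia.
  transitivity (qfact X (2 * N) * fps_tw (-1) (qfact X (2 * N)) * qfact (X ^+ 4) N
    * ((1 - x1) * (1 + x1) * (1 - x2) ^+ 2 * (1 - x2 ^+ 2))); first by ring.
  by rewrite IHN !Xc -/x1 -/x2; ring.
apply: eqmP => N; apply: (eqm_le (leqnSn N)).
have E1 : eqm N.+1 (E 1) (qfact X (2 * N)).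
  by apply: (@eqm_le _ (2 * N).+1); [lia | apply: eqm_euler1].
apply: (@eqm_trans _ _
  (qfact X (2 * N) * fps_tw (-1) (qfact X (2 * N)) * qfact (X ^+ 4) N)).
  by apply: eqmM; [apply: eqmM => //; apply: eqm_tw | apply: eqm_euler].
rewrite fin [E 2 ^+ 3]exprS; apply/eqm_sym; apply: eqmM; last exact/eqmX/eqm_euler.
by apply: (@eqm_le _ (2 * N).+1); [lia | apply: eqm_euler].
Qed.

(** Splits the squares by parity: (2m)^2 = 4m^2 and (2m+1)^2 = 8 m(m+1)/2 + 1. Two terms of [phi]
    match one of each series on the right. *)
Lemma phi_dissection :
  phi R = fps_sub 4 (fps_tw (-1) (phi R)) - 2%:R * X * fps_sub 8 (psi R).
Proof.
have fin N : \sum_(m < 2 * N) phi_term R m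
    = fps_sub 4 (fps_tw (-1) (\sum_(m < N) phi_term R m))
      - 2%:R * X * fps_sub 8 (\sum_(m < N) psi_term R m).
  elim: N => [|N IHN]; first by rewrite !big_ord0 !rmorph0 mulr0 subr0.
  have -> : (2 * N.+1 = (2 * N).+2)%N by lia.
  rewrite !big_ord_recr /= IHN !rmorphD /=.
  have -> : fps_sub 4 (fps_tw (-1) (phi_term R N))
      = X ^+ (4 * (N * N)) + X ^+ (4 * (N.+1 * N.+1)).
    rewrite rmorphM rmorphB /= rmorphXn /= !fps_twXn !rmorphN1.
    rewrite rmorphM rmorphB !rmorphM !rmorphXn !rmorphN1 /= !fps_subX // -!exprM.
    have -> : (-1) ^+ (N * N) = (-1) ^+ N :> fps R.
      by rewrite -signr_odd oddM andbb signr_odd.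
    have -> : (-1) ^+ (N.+1 * N.+1) = - (-1) ^+ N :> fps R.
      by rewrite -signr_odd oddM andbb signr_odd exprS mulN1r.
    by have /eqP := sqrr_sign (fps R) N; rewrite expr2 => /eqP s2;
       rewrite mulrBr !mulrA mulrN s2; ring.
  have -> : fps_sub 8 (psi_term R N) = X ^+ (8 * tri N) by rewrite fps_subXn.
  rewrite /phi_term exprS exprM sqrrN !expr1n.
  have tri2 : (8 * tri N = 4 * (N * N) + 4 * N)%N.
    by elim: (N) => // k IHk; rewrite triS; lia.
  rewrite tri2.
  have -> : (2 * N * (2 * N) = 4 * (N * N))%N by lia.
  have -> : ((2 * N).+1 * (2 * N).+1 = 4 * (N * N) + 4 * N + 1)%N by lia.
  have -> : ((2 * N).+2 * (2 * N).+2 = 4 * (N.+1 * N.+1))%N by lia.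
  by rewrite !exprD; ring.
apply: eqmP => N.
have psiN := @eqm_fps_sum _ _ N (@eqm_psi_term R).
have phiN := @eqm_fps_sum _ _ N (@eqm_phi_term R).
apply: (@eqm_trans _ _ (\sum_(m < 2 * N) phi_term R m)).
  by apply: (@eqm_le _ (2 * N)); [lia | apply/eqm_fps_sum/eqm_phi_term].
rewrite fin; apply/eqm_sym; apply: eqmD; first exact/eqm_sub/eqm_tw.
by apply/eqmN/eqmM => //; apply: eqm_sub.
Qed.

Lemma fps_cancelX k j f g : E k ^+ j * f = E k ^+ j * g -> f = g.
Proof. by apply: fps_cancel; rewrite coef_fps_exp0 coef_euler0 expr1n. Qed.

(** phi(-q), the theta series of squares with all signs positive. *)
Notation phip := (fps_tw (-1) (phi R)).

Lemma sqrN1 : (-1) ^+ 2 = 1 :> R. Proof. by rewrite sqrrN expr1n. Qed.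

Lemma phip_euler : phip * E 2 = fps_tw (-1) (E 1) ^+ 2.
Proof.
rewrite -rmorphXn -phi_euler rmorphM /=; congr (_ * _).
by rewrite (@tw_euler _ 2 1) ?sqrN1.
Qed.

(** After multiplication by E_2^2 E_4^2 this becomes the square of [euler_norm2]; [phip_psi] is
    similar. *)
Lemma phip_phi : phip * phi R = fps_sub 2 (phi R) ^+ 2.
Proof.
have sub_phi : fps_sub 2 (phi R) * E 4 = E 2 ^+ 2.
  rewrite -(@fps_sub_euler R 2 2) //.
  by rewrite -rmorphM phi_euler rmorphXn /= fps_sub_euler.
apply: (@fps_cancelX 2 2); apply: (@fps_cancelX 4 2).
transitivity ((E 1 * fps_tw (-1) (E 1) * E 4) ^+ 2).
  transitivity (E 4 ^+ 2 * (phip * E 2) * (phi R * E 2)); first by ring.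
  by rewrite phip_euler phi_euler; ring.
transitivity (E 2 ^+ 2 * (fps_sub 2 (phi R) * E 4) ^+ 2); last by ring.
by rewrite sub_phi euler_norm2; ring.
Qed.

Lemma phip_psi : phip * fps_sub 2 (psi R) = psi R ^+ 2.
Proof.
have sub_psi : fps_sub 2 (psi R) * E 2 = E 4 ^+ 2.
  rewrite -(@fps_sub_euler R 2 1) //.
  by rewrite -rmorphM psi_euler rmorphXn /= fps_sub_euler.
apply: (@fps_cancelX 2 2); apply: (@fps_cancelX 1 2).
transitivity ((E 1 * fps_tw (-1) (E 1) * E 4) ^+ 2).
  transitivity (E 1 ^+ 2 * (phip * E 2) * (fps_sub 2 (psi R) * E 2)); first by ring.
  by rewrite phip_euler sub_psi; ring.
transitivity (E 2 ^+ 2 * (psi R * E 1) ^+ 2); last by ring.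
by rewrite psi_euler euler_norm2; ring.
Qed.

Lemma fps_tw_subN1 d f : ~~ odd d -> fps_tw (-1) (fps_sub d f) = fps_sub d f.
Proof. by move=> d_even; rewrite fps_tw_sub // -signr_odd (negPf d_even). Qed.

Lemma fps_twN1X : fps_tw (-1) X = - X.
Proof. by rewrite fps_twX rmorphN1 mulN1r. Qed.

(* The difference D of the two sides is even by the dissection of phi, and
   the same dissection identifies it with -D(q^2). *)
Lemma phi_sqr :
  phi R ^+ 2 = fps_sub 2 (phip ^+ 2) - 4%:R * X * fps_sub 4 (psi R ^+ 2).
Proof.
pose D := phi R ^+ 2 - fps_sub 2 (phip ^+ 2) + 4%:R * X * fps_sub 4 (psi R ^+ 2).
have DE : D = fps_sub 4 (phip ^+ 2) + 4%:R * X ^+ 2 * fps_sub 8 (psi R ^+ 2)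
    - fps_sub 2 (phip ^+ 2).
  have s4 : fps_sub 4 (psi R ^+ 2) = fps_sub 4 phip * fps_sub 8 (psi R).
    by rewrite -phip_psi rmorphM /= fps_sub_sub.
  rewrite /D {1}phi_dissection s4 (rmorphXn (fps_sub 4)) (rmorphXn (fps_sub 8)) /=.
  by ring.
have twD : fps_tw (-1) D = D.
  rewrite DE rmorphB rmorphD !rmorphM rmorph_nat /= fps_twN1X !fps_tw_subN1 //.
  by ring.
have twE : fps_tw (-1) D
    = phip ^+ 2 - fps_sub 2 (phip ^+ 2) - 4%:R * X * fps_sub 4 (psi R ^+ 2).
  rewrite /D rmorphD rmorphB !rmorphM rmorph_nat /= !fps_tw_subN1 // fps_twN1X.
  by ring.
(* D being even, it may be replaced by D(-q), whose image under q -> q^2 is the negative of [DE]. *)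
have D2 : D = - fps_sub 2 D.
  rewrite -[in RHS]twD twE DE rmorphB rmorphB !rmorphM rmorph_nat /=.
  by rewrite !fps_sub_sub // fps_subX //; ring.
have D0 : D 0%N = 0.
  have phip0 : phip 0%N = phi R 0%N by rewrite coef_fps_tw mul1r.
  have X0 : X 0%N = 0 by [].
  rewrite coef_fpsD coef_fpsB coef0_sub !coef_fps_exp0 phip0 subrr add0r.
  by rewrite !coef_fpsM0 X0 mulr0 mul0r.
(* Each coefficient of positive index is 0 or the negative of the one at half its index. *)
have {D2 D0} : D = 0.
  apply: fpsP => n; elim/ltn_ind: n => -[|n] IHn //.
  rewrite D2 coef_fpsN coef_fps_sub; case: ifP => _; last exact: oppr0.
  by rewrite IHn ?oppr0 //; lia.
by rewrite /D => /eqP; rewrite -addrA addr_eq0 => /eqP ->; ring.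
Qed.

Lemma coef_dissect2 f A B n : f = fps_sub 2 A + X * fps_sub 2 B ->
  f (2 * n).+1 = B n.
Proof.
move=> ->; rewrite coef_fpsD coef_fpsXM !coef_fps_sub.
have -> : (2 %| (2 * n).+1)%N = false by lia.
by rewrite add0r dvdn_mulr // mulKn.
Qed.

Definition tau : fps R := X * E 1 ^+ 24.

Lemma tau0 : tau 0%N = 0.
Proof. by rewrite /tau coef_fpsXM. Qed.

Lemma tauS n : tau n.+1 = (E 1 ^+ 24) n.
Proof. exact: coef_fpsXMS. Qed.

(** For m > 0, tau(2m) is a coefficient of odd index of E_1^24, so only the odd part of the
    2-dissection matters. *)
Theorem tau_hecke2 m : tau (2 * m)%N = - (24%:R * tau m) - 2048%:R * fps_sub 2 tau m.
Proof.
pose A := phip ^+ 2; pose B := fps_sub 2 (psi R ^+ 2).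
have AB : A * B = psi R ^+ 4 by rewrite /A /B rmorphXn -exprMn phip_psi -exprM.
have phiAB : phi R ^+ 2 = fps_sub 2 A - 4%:R * X * fps_sub 2 B.
  by rewrite /B fps_sub_sub // phi_sqr.
have phipAB : phip ^+ 2 = fps_sub 2 A + 4%:R * X * fps_sub 2 B.
  rewrite -rmorphXn phiAB rmorphB !rmorphM rmorph_nat /= fps_twN1X !fps_tw_subN1 //.
  by ring.
(* Checked in q^2, where the left side is the product of phi^2 and its twist by -1. *)
have nAB : A ^+ 2 - 16%:R * X * B ^+ 2 = phi R ^+ 4.
  apply: (@fps_sub_inj _ 2) => //.
  have -> : fps_sub 2 (phi R ^+ 4) = phip ^+ 2 * phi R ^+ 2.
    by rewrite -exprMn phip_phi -exprM rmorphXn.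
  rewrite phiAB phipAB !(rmorph_nat, rmorphXn, rmorphM, rmorphB) /= fps_subX //.
  by ring.
have E24 : E 1 ^+ 24 = (phi R ^+ 2) ^+ 6 * fps_sub 2 (E 1 ^+ 12).
  have -> : fps_sub 2 (E 1 ^+ 12) = E 2 ^+ 12 by rewrite rmorphXn /= fps_sub_euler.
  transitivity ((phi R * E 2) ^+ 12); last by ring.
  by rewrite phi_euler; ring.
have sX := fps_subX R (isT : (0 < 2)%N); clearbody A B.
(* [C1] and [C0] are the odd and even parts of the binomial expansion of (A - 4qB)^6, with q^2
   renamed q: 24 = 6 * 4, 1280 = 20 * 4^3, 6144 = 6 * 4^5. *)
pose C1 := - (24%:R * (A * B) * A ^+ 4 + 1280%:R * X * (A * B) ^+ 3
  + 6144%:R * X ^+ 2 * (A * B) * B ^+ 4) * E 1 ^+ 12.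
pose C0 := (A ^+ 6 + 240%:R * X * (A * B) ^+ 2 * A ^+ 2 +
   3840%:R * X ^+ 2 * (A * B) ^+ 2 * B ^+ 2 + 4096%:R * X ^+ 3 * B ^+ 6) * E 1 ^+ 12.
have dis : E 1 ^+ 24 = fps_sub 2 C0 + X * fps_sub 2 C1.
  by rewrite E24 phiAB /C0 /C1; ring: sX.
have C1E : C1 = - (24%:R * E 1 ^+ 24) - 2048%:R * X * E 2 ^+ 24.
  (* Completes the square so that only AB and A^2 - 16qB^2 remain; 2048 = 1280 + 24 * 32. *)
  transitivity (- (24%:R * (A * B) * (A ^+ 2 - 16%:R * X * B ^+ 2) ^+ 2
     + 2048%:R * X * (A * B) ^+ 3) * E 1 ^+ 12).
    by rewrite /C1; ring.
  rewrite nAB AB.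
  transitivity (- (24%:R * (psi R * E 1) ^+ 4 * phi R ^+ 8 * E 1 ^+ 8)
     - 2048%:R * X * (psi R * E 1) ^+ 12).
    by ring.
  rewrite psi_euler.
  transitivity (- (24%:R * (phi R * E 2) ^+ 8 * E 1 ^+ 8)
     - 2048%:R * X * E 2 ^+ 24).
    by ring.
  by rewrite phi_euler; ring.
case: m => [|m].
  by rewrite muln0 coef0_sub tau0 !mulr0 subr0 oppr0.
have -> : (2 * m.+1 = (2 * m).+2)%N by lia.
have subtau : fps_sub 2 tau m.+1 = (X * E 2 ^+ 24) m.
  suff -> : fps_sub 2 tau = X * (X * E 2 ^+ 24) by rewrite coef_fpsXMS.
  by rewrite /tau rmorphM /= sX rmorphXn /= fps_sub_euler // expr2 mulrA.
rewrite subtau (tauS (2 * m).+1) (tauS m) (coef_dissect2 m dis) C1E.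
by rewrite coef_fpsB coef_fpsN -mulrA !coef_fps_natM.
Qed.

(** * The 3-dissection of Jacobi's series *)

Lemma sum_mul3 (F : nat -> fps R) N : \sum_(m < 3 * N) F m
  = \sum_(j < N) (F (3 * j)%N + F (3 * j).+1%N + F (3 * j).+2%N).
Proof.
elim: N => [|N IHN]; first by rewrite !big_ord0.
have -> : (3 * N.+1 = (3 * N).+3)%N by lia.
by rewrite !big_ord_recr /= IHN !addrA.
Qed.

(** Terms 3j and 3j+2 of Jacobi's series, those with exponent divisible by 3, after renaming q^3 to
    q. The subtraction is exact as j <= [tri j]. *)
Definition cube_term j : fps R := (-1) ^+ j *
  ((6 * j).+1%:R * X ^+ (3 * tri j - j) + (6 * j + 5)%:R * X ^+ (3 * tri j + j.+1)).

Lemma eqm_cube_term j : eqm j (cube_term j) 0.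
Proof.
have := tri_ge j => letri; rewrite /cube_term mulrDr !mulrA -[0]addr0.
by apply: eqmD; apply: eqm_MXn0; lia.
Qed.

(** Term 3j+1 has exponent 9 [tri j] + 1 and coefficient 3(2j+1) up to sign, so these terms form
    Jacobi's series in q^9 times -3q. *)
Lemma cube_dissection :
  E 1 ^+ 3 = fps_sub 3 (fps_sum cube_term) - 3%:R * X * E 9 ^+ 3.
Proof.
have tri3 j : ((tri (3 * j) = 3 * (3 * tri j - j))%N *
    (tri (3 * j).+1 = 9 * tri j + 1)%N *
    (tri (3 * j).+2 = 3 * (3 * tri j + j.+1))%N)%type.
  have tri30 : tri (3 * j) = (3 * (3 * tri j - j))%N.
    elim: j => // j IHj; have -> : (3 * j.+1 = (3 * j).+3)%N by lia.
    by rewrite !triS IHj; have := tri_ge j; lia.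
  by have := tri_ge j; split; [split|]; rewrite ?triS tri30; lia.
have term j : jacobi_term R (3 * j)%N + jacobi_term R (3 * j).+1
    + jacobi_term R (3 * j).+2
    = fps_sub 3 (cube_term j) - 3%:R * X * fps_sub 9 (jacobi_term R j).
  rewrite /jacobi_term /cube_term !tri3.
  have -> : ((2 * (3 * j).+1).+1 = 3 * (2 * j).+1)%N by lia.
  have -> : ((2 * (3 * j).+2).+1 = 6 * j + 5)%N by lia.
  have -> : ((2 * (3 * j)).+1 = (6 * j).+1)%N by lia.
  rewrite !(rmorph_nat, rmorphN1, rmorphXn, rmorphN, rmorphM, rmorphD) /=.
  rewrite !fps_subX // -!exprM exprD !exprS exprM !natrM.
  have -> : (-1) ^+ 3 = -1 :> fps R by ring.
  by ring.
rewrite -(@fps_sub_euler _ 9 1) // -rmorphXn /= -jacobi_cube.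
apply: eqmP => N; apply: (@eqm_trans _ _ (\sum_(m < 3 * N) jacobi_term R m)).
  by apply: (@eqm_le _ (3 * N)); [lia | apply/eqm_fps_sum/eqm_jacobi_term].
rewrite sum_mul3 (eq_bigr _ (fun (j : 'I_N) _ => term j)) sumrB -rmorph_sum.
rewrite -mulr_sumr -rmorph_sum /=; apply/eqm_sym; apply: eqmD.
  by apply/eqm_sub/eqm_fps_sum/eqm_cube_term.
by apply/eqmN/eqmM => //; apply/eqm_sub/eqm_fps_sum/eqm_jacobi_term.
Qed.

Lemma coef_dissect3 f A B C n :
  f = fps_sub 3 A + X * fps_sub 3 B + X ^+ 2 * fps_sub 3 C ->
  f (3 * n).+2 = C n.
Proof.
move=> ->; rewrite !coef_fpsD expr2 -mulrA !coef_fpsXM !coef_fps_sub.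
have -> : (3 %| (3 * n).+2)%N = false by lia.
have -> : (3 %| (3 * n).+1)%N = false by lia.
by rewrite !add0r dvdn_mulr // mulKn.
Qed.

(** * Norms by a root of x^2 + x + 1 and the Hecke relation at 3 *)

Section CubeRootOfUnity.

Variable w : R.
Hypothesis w_root : w ^+ 2 + w + 1 = 0.

Let W : fps R := fpsC w.

Lemma fpsC_cube_root : W ^+ 2 + W + 1 = 0.
Proof.
have := congr1 (@fpsC R) w_root.
by rewrite !rmorphD rmorphXn rmorph1 rmorph0.
Qed.

Lemma cube_root_expr3 : w ^+ 3 = 1.
Proof.
apply/eqP; rewrite -subr_eq0; apply/eqP.
by transitivity ((w - 1) * (w ^+ 2 + w + 1)); [ring | rewrite w_root mulr0].
Qed.

Lemma norm3_factor (x : fps R) :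
  (1 - x) * (1 - W * x) * (1 - W ^+ 2 * x) = 1 - x ^+ 3.
Proof.
(* The relation on W enters [ring] through an explicit multiple of W^2 + W + 1. *)
transitivity (1 - x ^+ 3 + (W ^+ 2 + W + 1) *
  ((1 - x) * ((W - 1) * x ^+ 2 - x))); last by rewrite fpsC_cube_root mul0r addr0.
by ring.
Qed.

(** The three conjugates of a factor of index k multiply to 1 - q^(3k) if 3 does not divide k, which
    gives E_3/E_9 in all, and to a cube otherwise, which gives E_3^3. *)
Lemma euler_norm3 :
  E 1 * fps_tw w (E 1) * fps_tw (w ^+ 2) (E 1) * E 9 = E 3 ^+ 4.
Proof.
have W3 : W ^+ 3 = 1 by rewrite -rmorphXn cube_root_expr3 rmorph1.
have fin N : qfact X (3 * N) * fps_tw w (qfact X (3 * N))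
      * fps_tw (w ^+ 2) (qfact X (3 * N)) * qfact (X ^+ 9) N
    = qfact (X ^+ 3) (3 * N) * qfact (X ^+ 3) N ^+ 3.
  elim: N => [|N IHN]; first by rewrite muln0 !qfact0 !rmorph1 expr1n !mulr1.
  have -> : (3 * N.+1 = (3 * N).+3)%N by lia.
  rewrite !qfactS !rmorphM /= !rmorphB !rmorph1 /= !fps_twXn rmorphXn -/W.
  have W31 : W ^+ (3 * N).+1 = W by rewrite exprS exprM W3 expr1n mulr1.
  have W32 : W ^+ (3 * N).+2 = W ^+ 2 by rewrite exprS W31.
  have W33 : W ^+ (3 * N).+3 = 1 by rewrite exprS W32 -exprS.
  have W4 : (W ^+ 2) ^+ 2 = W by rewrite -exprM exprS W3 mulr1.
  rewrite -![(W ^+ 2) ^+ _]exprM ![(2 * _)%N]mulnC !exprM W31 W32 W33 W4 expr1n.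
  set x1 := X ^+ (3 * N).+1; set x2 := X ^+ (3 * N).+2; set x3 := X ^+ (3 * N).+3.
  have -> : (X ^+ 9) ^+ N.+1 = x3 ^+ 3.
    by rewrite /x3 -!exprM; congr (_ ^+ _); lia.
  have -> : (X ^+ 3) ^+ N.+1 = x3.
    by rewrite /x3 -!exprM; congr (_ ^+ _); lia.
  have Xc k : (X ^+ 3) ^+ k = (X ^+ k) ^+ 3 by rewrite -!exprM mulnC.
  rewrite !Xc -/x1 -/x2 -/x3; clearbody x1 x2 x3.
  transitivity ((qfact X (3 * N) * fps_tw w (qfact X (3 * N))
      * fps_tw (w ^+ 2) (qfact X (3 * N)) * qfact (X ^+ 9) N)
    * ((1 - x1) * (1 - W * x1) * (1 - W ^+ 2 * x1))
    * ((1 - x2) * (1 - W * x2) * (1 - W ^+ 2 * x2))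
    * ((1 - x3) ^+ 3 * (1 - x3 ^+ 3))); first by ring.
  by rewrite IHN (norm3_factor x1) (norm3_factor x2); ring.
apply: eqmP => N; apply: (eqm_le (leqnSn N)).
have E1 : eqm N.+1 (E 1) (qfact X (3 * N)).
  by apply: (@eqm_le _ (3 * N).+1); [lia | apply: eqm_euler1].
apply: (@eqm_trans _ _ (qfact X (3 * N) * fps_tw w (qfact X (3 * N))
      * fps_tw (w ^+ 2) (qfact X (3 * N)) * qfact (X ^+ 9) N)).
  by do ![apply: eqmM | apply: eqm_tw | apply: eqm_euler | done].
rewrite fin [E 3 ^+ 4]exprS; apply/eqm_sym; apply: eqmM; last exact/eqmX/eqm_euler.
by apply: (@eqm_le _ (3 * N).+1); [lia | apply: eqm_euler].
Qed.

Theorem tau_hecke3 m : tau (3 * m)%N = 252%:R * tau m - 177147%:R * fps_sub 3 tau m.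
Proof.
pose P := fps_sum cube_term.
have [S SE] : {S | S = E 3 ^+ 3} by exists (E 3 ^+ 3).
have E1P : E 1 ^+ 3 = fps_sub 3 P - 3%:R * X * fps_sub 3 S.
  by rewrite cube_dissection SE rmorphXn /= fps_sub_euler.
(* In q^3 this is the cube of [euler_norm3]: the conjugates of p - 3qs multiply to p^3 - 27 q^3
   s^3. *)
have PS : P ^+ 3 * S = E 1 ^+ 12 + 27%:R * X * S ^+ 4.
  apply: (@fps_sub_inj _ 3) => //.
  rewrite [RHS]rmorphD /= rmorphXn /= fps_sub_euler // (exprM _ 4 3) -euler_norm3.
  rewrite !exprMn -!rmorphXn /= E1P !rmorphB !rmorphM /= !fps_twX.
  have tw3 v f : v ^+ 3 = 1 -> fps_tw v (fps_sub 3 f) = fps_sub 3 f.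
    exact: fps_tw_sub.
  have w23 : (w ^+ 2) ^+ 3 = 1 by rewrite -exprM mulnC exprM cube_root_expr3 expr1n.
  rewrite !tw3 ?cube_root_expr3 // !rmorph_nat !rmorphXn /= fps_subX // -/W.
  have -> : E 9 ^+ 3 = fps_sub 3 S by rewrite SE rmorphXn /= fps_sub_euler.
  set p := fps_sub 3 P; set s := fps_sub 3 S.
  transitivity (p ^+ 3 * s + (W ^+ 2 + W + 1) * s * (3%:R * X * s) *
     ((p - 3%:R * X * s) * ((W - 1) * (3%:R * X * s) - p))); last first.
    by ring.
  by rewrite fpsC_cube_root !mul0r addr0.
have sX := fps_subX R (isT : (0 < 3)%N); clearbody P.
(* [A], [B], [C] sort the expansion of (p - 3qs)^8 by the exponent of q modulo 3; [C] involves P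
   only through P^3 S. *)
pose A := P ^+ 8 - 1512%:R * X * P ^+ 5 * S ^+ 3 + 20412%:R * X ^+ 2 * P ^+ 2 * S ^+ 6.
pose B := - (24%:R * P ^+ 7 * S) + 5670%:R * X * P ^+ 4 * S ^+ 4
  - 17496%:R * X ^+ 2 * P * S ^+ 7.
pose C := 252%:R * (P ^+ 3 * S) ^+ 2 - 13608%:R * X * (P ^+ 3 * S) * S ^+ 4
  + 6561%:R * X ^+ 2 * S ^+ 8.
have dis : E 1 ^+ 24 = fps_sub 3 A + X * fps_sub 3 B + X ^+ 2 * fps_sub 3 C.
  by rewrite (exprM _ 3 8) E1P /A /B /C; ring: sX.
(* After substituting [PS] the mixed term cancels, as 2 * 27 * 252 = 13608, and the last coefficient
   becomes -3^11. *)
have CE : C = 252%:R * E 1 ^+ 24 - 177147%:R * X ^+ 2 * E 3 ^+ 24.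
  by rewrite /C PS SE; ring.
case: m => [|m].
  by rewrite muln0 coef0_sub tau0 !mulr0 subr0.
have -> : (3 * m.+1 = (3 * m).+3)%N by lia.
have subtau : fps_sub 3 tau m.+1 = (X ^+ 2 * E 3 ^+ 24) m.
  suff -> : fps_sub 3 tau = X * (X ^+ 2 * E 3 ^+ 24) by rewrite coef_fpsXMS.
  by rewrite /tau rmorphM /= sX rmorphXn /= fps_sub_euler // mulrA -exprS.
rewrite subtau (tauS (3 * m).+2) (tauS m) (coef_dissect3 m dis) CE.
by rewrite coef_fpsB -mulrA !coef_fps_natM.
Qed.

End CubeRootOfUnity.

End Hecke.

(** * Generating function of regular partitions *)

Section RegularPartitions.

Variable l : nat.

(* The l-regular partitions of n with parts at most m, provided the
   recursion depth satisfies m + n <= k. *)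
Fixpoint reg_parts k m n : seq (seq nat) :=
  if k is k'.+1 then
    if m is m'.+1 then
      reg_parts k' m' n ++
      (if ~~ (l %| m)%N && (m <= n)%N
       then [seq m :: s | s <- reg_parts k' m (n - m)%N] else [::])
    else nseq (n == 0%N) [::]
  else nseq (n == 0%N) [::].

Lemma geq_trans : transitive geq.
Proof. by move=> b a c /= ba cb; apply: leq_trans cb ba. Qed.

Lemma mem_map_cons (m x : nat) (t : seq nat) (L : seq (seq nat)) :
  (x :: t \in [seq m :: s | s <- L]) = (x == m) && (t \in L).
Proof.
apply/mapP/andP => [[s sL [-> ->]]|[/eqP -> tL]]; first by rewrite eqxx.
by exists t.
Qed.

Lemma nil_map_cons (m : nat) (L : seq (seq nat)) :
  ([::] \in [seq m :: s | s <- L]) = false.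
Proof. by apply/mapP => -[]. Qed.

Lemma mem_reg_parts k m n s : (m + n <= k)%N ->
  (s \in reg_parts k m n)
  = [&& is_partition n s, regular l s & all (geq m) s].
Proof.
have base j r : (r \in nseq (j == 0%N) ([::] : seq nat))
    = [&& is_partition j r, regular l r & all (geq 0) r].
  case: r => [|x r]; rewrite /is_partition mem_nseq /=; first by case: j.
  by rewrite andbF; case: x => [|x] /=; rewrite ?ltn0 ?ltnn /= ?andbF.
elim: k m n s => [|k IHk] [|m] n s //; try by move=> _; apply: base.
move=> le_mnk; rewrite [reg_parts _ _ _]/= mem_cat IHk; last by lia.
have IHm : (m.+1 <= n)%N -> forall t, (t \in reg_parts k m.+1 (n - m.+1)%N)
    = [&& is_partition (n - m.+1)%N t, regular l t & all (geq m.+1) t].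
  by move=> lemn t; apply: IHk; lia.
case: s => [|x t].
  by case: ifP => _; rewrite ?nil_map_cons orbF /is_partition /= !andbT.
(* The head decides the list: m+1 can only come from the second one, any other head from the
   first. *)
have [->|ne_xm] := eqVneq x m.+1; last first.
  have -> : (x :: t \in if ~~ (l %| m.+1)%N && (m < n)%N then
      [seq m.+1 :: s | s <- reg_parts k m.+1 (n - m.+1)%N] else [::]) = false.
    by case: ifP => // _; rewrite mem_map_cons (negPf ne_xm).
  rewrite orbF /is_partition /= path_sortedE; last first.
    exact: geq_trans.
  case: (boolP (all (geq x) t)) => [le_tx|_] //=.
  have [le_xm|lt_mx] := leqP x m.
    have -> : (x <= m.+1)%N by lia.
    have -> : all (geq m) t by apply: sub_all le_tx => y /=; lia.
    by have -> : all (geq m.+1) t by apply: sub_all le_tx => y /=; lia.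
  by have -> : (x <= m.+1)%N = false by lia.
rewrite /is_partition /= ltnn !andbF /= leqnn path_sortedE; last first.
  exact: geq_trans.
case: (boolP (l %| m.+1)%N) => _ /=; first by rewrite !andbF.
have [lemn|ltnm] := leqP m.+1 n; last first.
  have -> : (m.+1 + sumn t == n)%N = false by lia.
  by rewrite !andbF.
rewrite mem_map_cons eqxx IHm //= /is_partition.
have -> : (m.+1 + sumn t == n)%N = (sumn t == n - m.+1)%N by lia.
by case: (sorted _ t); case: (all (leq 1) t); case: (all (geq _) t);
   case: (regular l t); case: (_ == _).
Qed.

Lemma uniq_reg_parts k m n : (m + n <= k)%N -> uniq (reg_parts k m n).
Proof.
elim: k m n => [|k IHk] [|m] n lek; try by case: n {lek}.
rewrite [reg_parts _ _ _]/= cat_uniq IHk /=; last by lia.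
case: ifP => [/andP[_ lemn]|_] //; apply/andP; split.
  apply/hasPn => _ /mapP[s _ ->]; rewrite mem_reg_parts; last by lia.
  by rewrite /= ltnn !andbF.
by rewrite map_inj_uniq ?IHk //; [lia | move=> s t []].
Qed.

Definition num_reg_parts m n := size (reg_parts (m + n)%N m n).

(** The recursion depth is immaterial: two duplicate-free lists with the same members have the same
    size. *)
Lemma size_reg_parts k m n : (m + n <= k)%N ->
  size (reg_parts k m n) = num_reg_parts m n.
Proof.
move=> lek; apply/perm_size/uniq_perm; rewrite ?uniq_reg_parts //.
by move=> s; rewrite !mem_reg_parts.
Qed.

Lemma num_reg_parts0 n : num_reg_parts 0 n = (n == 0%N).
Proof. by case: n. Qed.

Lemma num_reg_partsS m n : num_reg_parts m.+1 n = (num_reg_parts m n +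
  (if ~~ (l %| m.+1)%N && (m.+1 <= n)%N then num_reg_parts m.+1 (n - m.+1)%N
   else 0))%N.
Proof.
rewrite {1}/num_reg_parts addSn [reg_parts _ _ _]/= size_cat size_reg_parts //.
congr (_ + _)%N; case: ifP => // /andP[_ lemn].
by rewrite size_map size_reg_parts //; lia.
Qed.

Lemma num_reg_parts_stable m n : (n <= m)%N ->
  num_reg_parts m n = num_reg_parts n n.
Proof.
move/subnK <-; elim: (m - n)%N => // k IHk.
by rewrite addSn num_reg_partsS IHk [(_ < n)%N]ltnNge leq_addl andbF addn0.
Qed.

(** The encoded finite set and the enumeration list the same partitions, since the parts of a
    partition of n are at most n. *)
Lemma num_regular_partitionsE n : num_regular_partitions l n = num_reg_parts n n.
Proof.
rewrite /num_regular_partitions cardE -(size_map (@parts n)).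
apply/perm_size/uniq_perm.
- by rewrite map_inj_uniq ?enum_uniq //; apply: parts_inj.
- exact: uniq_reg_parts.
move=> s; rewrite mem_reg_parts //; apply/mapP/and3P.
  case=> t; rewrite mem_enum inE => /andP[pt rt] ->; split=> //.
  by apply/allP => _ /mapP[k _ ->] /=; rewrite -ltnS.
case=> ps rs _; have [t ts] := partition_in_bseq ps.
by exists t; rewrite // mem_enum inE ts ps rs.
Qed.

End RegularPartitions.

Section GeneratingFunction.

Variables (R : comNzRingType) (l : nat).
Notation X := (fpsX R).
Notation E := (@euler R).

Definition reg_gf : fps R := Fps (fun n => (num_regular_partitions l n)%:R).
Definition reg_parts_gf m : fps R := Fps (fun n => (num_reg_parts l m n)%:R).

Lemma coef_fpsXnM k (f : fps R) n :
  (X ^+ k * f) n = if (k <= n)%N then f (n - k)%N else 0.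
Proof.
elim: k n => [|k IHk] n; first by rewrite mul1r subn0.
by rewrite exprS -mulrA coef_fpsXM; case: n => [|n] //; rewrite IHk.
Qed.

Lemma reg_parts_gfS m : reg_parts_gf m
  = reg_parts_gf m.+1 * (if (l %| m.+1)%N then 1 else 1 - X ^+ m.+1).
Proof.
have gfS n : reg_parts_gf m.+1 n = reg_parts_gf m n +
    (if (l %| m.+1)%N then 0 else (X ^+ m.+1 * reg_parts_gf m.+1) n).
  rewrite coef_fpsXnM /= num_reg_partsS natrD.
  by case: (l %| m.+1)%N => //=; case: ifP.
apply: fpsP => n; case: ifP gfS => _ gfS; first by rewrite mulr1 gfS addr0.
by rewrite mulrBr mulr1 coef_fpsB gfS [reg_parts_gf _ * _]mulrC addrK.
Qed.

(** Multiplying by all factors leaves those of index divisible by l; with bound lN, each of the N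
    blocks of l indices keeps only its last. *)
Lemma reg_parts_gf_qfact N : (0 < l)%N ->
  reg_parts_gf (l * N)%N * qfact X (l * N) = qfact (X ^+ l) N.
Proof.
move=> l_gt0.
have gfM m : reg_parts_gf m * qfact X m
    = \prod_(i < m) (if (l %| i.+1)%N then 1 - X ^+ i.+1 else 1).
  elim: m => [|m IHm].
    rewrite big_ord0 qfact0 mulr1; apply: fpsP => n.
    by rewrite coef_fps1 /= num_reg_parts0.
  rewrite big_ord_recr -IHm /= qfactS (reg_parts_gfS m).
  by case: ifP => _; ring.
have block k M : (0 < k)%N -> \prod_(i < k) (if (k %| (k * M + i).+1)%N
    then 1 - X ^+ (k * M + i).+1 else 1) = 1 - X ^+ (k * M.+1).
  case: k => // k _; rewrite big_ord_recr /= big1 => [|i _].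
    have -> : (k.+1 * M + k).+1 = (k.+1 * M.+1)%N by lia.
    by rewrite mul1r dvdn_mulr.
  by rewrite -addnS dvdn_addr ?dvdn_mulr // gtnNdvd // ltnS.
rewrite gfM; elim: N => [|N IHN]; first by rewrite muln0 big_ord0 qfact0.
by rewrite qfactS -IHN mulnS addnC big_split_ord /= block // exprM.
Qed.

Theorem reg_gf_euler : (0 < l)%N -> reg_gf * E 1 = E l.
Proof.
move=> l_gt0; apply: eqmP => N; apply: (eqm_le (leqnSn N)).
have leN : (N <= l * N)%N by rewrite leq_pmull.
apply: (@eqm_trans _ _ (reg_parts_gf (l * N)%N * qfact X (l * N))).
  apply: eqmM; last by apply: (@eqm_le _ (l * N).+1); rewrite ?ltnS //; apply: eqm_euler1.
  move=> n; rewrite ltnS => leNn.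
  by rewrite /= num_regular_partitionsE -(@num_reg_parts_stable _ (l * N)) //; lia.
by rewrite reg_parts_gf_qfact //; apply/eqm_sym/eqm_euler.
Qed.

End GeneratingFunction.

(** * Reduction modulo 5 *)

Section CharacteristicFive.

Variable R : comNzRingType.
Hypothesis char5 : 5%:R = 0 :> R.
Notation X := (fpsX R).
Notation E := (@euler R).

Lemma euler_frobenius d : (0 < d)%N -> E (5 * d) = E d ^+ 5.
Proof.
have fchar5 : 5%:R = 0 :> fps R by rewrite -(rmorph_nat (@fpsC R)) char5 rmorph0.
move=> d_gt0; apply: eqmP => N; apply: (eqm_le (leqnSn N)).
apply: (@eqm_trans _ _ (qfact (X ^+ (5 * d)) N)).
  by apply: eqm_euler; rewrite muln_gt0.
have -> : qfact (X ^+ (5 * d)) N = qfact (X ^+ d) N ^+ 5.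
  rewrite /qfact -prodrXl; apply: eq_bigr => i _.
  have -> : (X ^+ (5 * d)) ^+ i.+1 = ((X ^+ d) ^+ i.+1) ^+ 5.
    by rewrite -!exprM; congr (_ ^+ _); lia.
  move: (_ ^+ i.+1) => x.
  (* The Frobenius identity, with the multiple of 5 between (1 - x)^5 and 1 - x^5 written out. *)
  transitivity ((1 - x) ^+ 5 + 5%:R * (x - 2%:R * x ^+ 2 + 2%:R * x ^+ 3 - x ^+ 4)).
    by ring.
  by rewrite fchar5 mul0r addr0.
by apply/eqmX/eqm_sym/eqm_euler.
Qed.

Theorem reg25_gf : reg_gf R 25 = E 1 ^+ 24.
Proof.
apply: (@fps_cancelX _ 1 1); rewrite expr1 mulrC reg_gf_euler //.
by rewrite (@euler_frobenius 5) // (@euler_frobenius 1) // -exprM -exprS.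
Qed.

Lemma num_regular25_tau n :
  (0 < n)%N -> (num_regular_partitions 25 (n - 1)%N)%:R = tau R n.
Proof.
case: n => // n _; rewrite subn1 tauS -reg25_gf.
by [].
Qed.

(** For u_k = tau(p^k m) one has u_1 = c u_0, as p does not divide m, and u_(k+2) = c u_(k+1) + d
    u_k. Hence u_3 = (c^3 + 2cd) u_0, and u_k = 0 gives u_(k+4) = (c^3 + 2cd) u_(k+1). *)
Lemma tau_vanish p (c d : R) m a : (0 < p)%N ->
  (forall k, tau R (p * k)%N = c * tau R k + d * fps_sub p (tau R) k) ->
  c ^+ 3 + 2%:R * c * d = 0 -> d * (c ^+ 2 + d) = 1 ->
  ~~ (p %| m)%N -> tau R (p ^ (4 * a + 3) * m)%N = 0.
Proof.
move=> p_gt0 hecke cd3 cd4 npm; pose u k := tau R (p ^ k * m)%N.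
have u1 : u 1%N = c * u 0%N.
  by rewrite /u expn1 hecke coef_fps_sub (negPf npm) mulr0 addr0 mul1n.
have uS k : u k.+2 = c * u k.+1 + d * u k.
  rewrite {1}/u expnS -mulnA hecke coef_fps_sub expnS -mulnA dvdn_mulr //.
  by rewrite mulKn // /u expnS mulnA.
rewrite -/(u (4 * a + 3)%N); elim: a => [|a IHa].
  rewrite !uS u1; transitivity ((c ^+ 3 + 2%:R * c * d) * u 0%N); first by ring.
  by rewrite cd3 mul0r.
have -> : (4 * a.+1 + 3 = (4 * a + 3).+4)%N by lia.
rewrite !uS IHa; transitivity ((c ^+ 3 + 2%:R * c * d) * u (4 * a + 3).+1).
  by ring.
by rewrite cd3 mul0r.
Qed.

(** Modulo 5, -24 is 1 and -2^11 is 2; [red] takes the explicit quotients by 5. *)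
Lemma tau_vanish2 m a : ~~ (2 %| m)%N -> tau R (2 ^ (4 * a + 3) * m)%N = 0.
Proof.
have red (x y z : R) : x = y + 5%:R * z -> x = y.
  by rewrite char5 mul0r addr0.
apply: (@tau_vanish 2 1 2%:R) => // [k||]; rewrite ?tau_hecke2.
- apply: (@red _ _ (- (5%:R * tau R k) - 410%:R * fps_sub 2 (tau R) k)); ring.
- apply: (@red _ _ 1); ring.
- apply: (@red _ _ 1); ring.
Qed.

(** Modulo 5, 252 is 2 and -3^11 is -2. *)
Lemma tau_vanish3 (w : R) m a : w ^+ 2 + w + 1 = 0 ->
  ~~ (3 %| m)%N -> tau R (3 ^ (4 * a + 3) * m)%N = 0.
Proof.
have red (x y z : R) : x = y + 5%:R * z -> x = y.
  by rewrite char5 mul0r addr0.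
move=> w_root.
apply: (@tau_vanish 3 2%:R (- 2%:R)) => // [k||]; rewrite ?(tau_hecke3 w_root).
- apply: (@red _ _ (50%:R * tau R k - 35429%:R * fps_sub 3 (tau R) k)); ring.
- apply: (@red _ _ 0); ring.
- apply: (@red _ _ (-1)); ring.
Qed.

End CharacteristicFive.

(** As 5 is 2 modulo 3, F_5 itself has no root of x^2 + x + 1; its algebraic closure does. *)
Lemma char5_cube_root : exists (K : fieldType) (w : K),
  w ^+ 2 + w + 1 = 0 /\ 5 \in [pchar K].
Proof.
have [K [FtoK _]] := countable_algebraic_closure 'F_5.
have charK : 5 \in [pchar K] by rewrite (fmorph_pchar FtoK) pchar_Fp.
have [w] := @solve_monicpoly K 2 (fun=> -1) isT.
rewrite !big_ord_recl big_ord0 /= => w2; exists K, w; split=> //.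
by rewrite w2 expr0 expr1; ring.
Qed.

(** Divisibility by 5 of a natural number is vanishing of its image in a field of characteristic
    5. *)
Lemma num_regular25_dvd5 p m a : p \in [:: 2; 3]%N -> ~~ (p %| m)%N ->
  num_regular_partitions 25 (p ^ (4 * a + 3) * m - 1)%N = 0 %[mod 5].
Proof.
move=> p23 npm; have [K [w [w_root charK]]] := char5_cube_root.
have char5 : 5%:R = 0 :> K by apply/eqP; rewrite -(dvdn_pcharf charK).
apply/eqP; rewrite mod0n -/(5 %| _)%N (dvdn_pcharf charK).
have m_gt0 : (0 < m)%N by case: m npm => //; rewrite dvdn0.
rewrite num_regular25_tau //; last first.
  by rewrite muln_gt0 expn_gt0 m_gt0; move: p23; rewrite !inE => /orP[]/eqP->.
move: p23 npm; rewrite !inE => /orP[]/eqP-> npm; apply/eqP.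
  exact: tau_vanish2.
exact: (@tau_vanish3 K char5 w m a w_root).
Qed.

Local Close Scope ring_scope.

Theorem corollary4p7 (alpha beta n : nat) (halpha : 1 <= alpha) :
  (forall i : nat, i \in [:: 1; 2] ->
     num_regular_partitions 25
       (2 ^ (4 * beta) * 3 ^ (4 * alpha) * n
        + (i + 3) * 2 ^ (4 * beta) * 3 ^ (4 * alpha - 1) - 1)
     = 0 %[mod 5]) /\
  num_regular_partitions 25
    (2 ^ (4 * alpha) * 3 ^ (4 * beta) * n
     + 2 ^ (4 * alpha - 1) * 3 ^ (4 * beta + 1) - 1)
  = 0 %[mod 5].
Proof.
(* As alpha >= 1, the exponent 4 alpha - 1 has the form 4a + 3 with a = alpha - 1. *)
have e4 : 4 * alpha = (4 * alpha.-1 + 3).+1 by lia.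
rewrite e4 subn1 /=; split=> [i i12|].
  (* The cofactor of the power of 3 is prime to 3 because i is 1 or 2. *)
  have -> : 2 ^ (4 * beta) * 3 ^ (4 * alpha.-1 + 3).+1 * n
      + (i + 3) * 2 ^ (4 * beta) * 3 ^ (4 * alpha.-1 + 3)
    = 3 ^ (4 * alpha.-1 + 3) * (2 ^ (4 * beta) * (3 * n + i + 3)).
    by rewrite [3 ^ _.+1]expnS; nia.
  apply: num_regular25_dvd5 => //.
  rewrite Euclid_dvdM // Euclid_dvdX //=.
  by move: i12; rewrite !inE => /orP[]/eqP->; lia.
(* The cofactor of the power of 2 is odd, as 2n + 3 is. *)
have -> : 2 ^ (4 * alpha.-1 + 3).+1 * 3 ^ (4 * beta) * n
    + 2 ^ (4 * alpha.-1 + 3) * 3 ^ (4 * beta + 1)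
  = 2 ^ (4 * alpha.-1 + 3) * (3 ^ (4 * beta) * (2 * n + 3)).
  by rewrite addn1 ![_ ^ _.+1]expnS; nia.
apply: num_regular25_dvd5 => //.
by rewrite Euclid_dvdM // Euclid_dvdX //=; lia.
Qed.
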